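(* Let $\mathbb{K}$ be any field, let $3\le n<m$ be integers, let $S=\Gamma_m(n)$, and let $R=\mathbb{K}[S]$. Then the Poincaré series $\mathcal{P}^R_{\mathbb{K}}(z)=\sum_{i\ge0}\beta_i^R(\mathbb{K})z^i$ of the residue field $\mathbb{K}$ of $R$ is $$\mathcal{P}^R_{\mathbb{K}}(z)=\frac{1+z}{1-(m-2)z+z^2}.$$
   Context: $\Gamma_m(n)$ is the numerical semigroup generated by $\{m,m+1,\ldots,2m-1\}\setminus\{m+n\}$. For a numerical semigroup $S$, $\mathbb{K}[S]=\mathbb{K}[t^s\mid s\in S]\subseteq\mathbb{K}[t]$, with homogeneous maximal ideal $\mathfrak m=(t^s\mid s\in S,\ s>0)$ and residue field $\mathbb{K}=\mathbb{K}[S]/\mathfrak m$. $\beta_i^R(\mathbb{K})=\dim_{\mathbb{K}}\operatorname{Tor}_i^R(\mathbb{K},\mathbb{K})$. The equality is one of formal power series in $z$. *)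

(* Defs.v *)
From HB Require Import structures.
From mathcomp Require Import all_boot all_order all_algebra.
From mathcomp Require Import boolp zify.

Set Implicit Arguments.
Unset Strict Implicit.
Unset Printing Implicit Defensive.

Import GRing.Theory.
Local Open Scope ring_scope.

(** ** Submonoids of the natural numbers and their semigroup rings *)

(* Finiteness of the complement plays no role in the construction of K[S], so
   it is not a field; see [Gamma_cofinite] for the semigroups of interest. *)
Record submonoid := Submonoid {
  submon_mem :> pred nat;
  submon0 : submon_mem 0%N;
  submonD : forall a b, submon_mem a -> submon_mem b -> submon_mem (a + b)%N }.

Definition generated_mem (A : pred nat) : pred nat :=
  fun k => `[< exists2 s : seq nat, all A s & sumn s = k >].

Lemma generated_mem0 A : generated_mem A 0%N.
Proof. by apply/asboolP; exists [::]. Qed.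

Lemma generated_memD A a b :
  generated_mem A a -> generated_mem A b -> generated_mem A (a + b)%N.
Proof.
move=> /asboolP[s As <-] /asboolP[u Au <-]; apply/asboolP; exists (s ++ u).
  by rewrite all_cat As.
by rewrite sumn_cat.
Qed.

Definition generated (A : pred nat) : submonoid :=
  Submonoid (generated_mem0 A) (@generated_memD A).

Definition Gamma (m n : nat) : submonoid :=
  generated [pred k | (m <= k < 2 * m)%N && (k != m + n)%N].

Lemma Gamma_cofinite m n : (3 <= n)%N -> (n < m)%N ->
  forall k, (2 * m <= k)%N -> Gamma m n k.
Proof.
move=> n3 nm; elim/ltn_ind=> k IH mk.
have gen1 j : (m <= j < 2 * m)%N && (j != m + n)%N -> Gamma m n j.
  by move=> Aj; apply/asboolP; exists [:: j]; rewrite /= ?Aj ?addn0.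
have [k3|k3] := ltnP k (3 * m); last first.
  rewrite -(@subnK m k); last by lia.
  by apply: submonD; [apply: IH; lia | apply: gen1; lia].
have [->|kn] := eqVneq k (2 * m + n)%N.
  have -> : (2 * m + n = (m + 1) + (m + (n - 1)))%N by lia.
  by apply: submonD; apply: gen1; lia.
rewrite -(@subnK m k); last by lia.
by apply: submonD; apply: gen1; lia.
Qed.

Section SemigroupRing.
Variables (K : fieldType) (S : submonoid).

(* The polynomials in t = 'X that are K-combinations of the t^s, s in S. *)
Definition sgpoly : {pred {poly K}} :=
  fun f => [forall i : 'I_(size f), (f`_i != 0) ==> S i].

Lemma sgpolyP (f : {poly K}) : reflect (forall i, f`_i != 0 -> S i) (f \in sgpoly).
Proof.
apply: (iffP forallP) => [Sf i fi|Sf i]; last by apply/implyP/Sf.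
have lt_i : (i < size f)%N.
  by rewrite ltnNge; apply: contraNN fi => le_i; rewrite nth_default.
exact: (implyP (Sf (Ordinal lt_i))).
Qed.

Lemma sgpoly_closed : subring_closed sgpoly.
Proof.
split=> [|f g /sgpolyP Sf /sgpolyP Sg|f g /sgpolyP Sf /sgpolyP Sg].
- apply/sgpolyP=> i; rewrite coef1; case: i => [|i] /=; last by rewrite eqxx.
  by rewrite submon0.
- apply/sgpolyP=> i; rewrite coefB; have [fi0|/Sf//] := eqVneq f`_i 0.
  by rewrite fi0 sub0r oppr_eq0 => /Sg.
- apply/sgpolyP=> i; rewrite coefM; apply: contraNT => nSi.
  apply/eqP/big1 => j _; apply/eqP; apply: contraNT nSi.
  rewrite mulf_eq0 negb_or => /andP[/Sf Sj /Sg Sij].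
  by rewrite -(subnKC (leq_ord j)) submonD.
Qed.

HB.instance Definition _ := GRing.isSubringClosed.Build {poly K} sgpoly
  sgpoly_closed.

Record sgring := SgRing { sgval :> {poly K}; _ : sgval \in sgpoly }.

HB.instance Definition _ := [isSub for sgval].
HB.instance Definition _ := [Choice of sgring by <:].
HB.instance Definition _ := [SubChoice_isSubComNzRing of sgring by <:].

(* The quotient map K[S] -> K[S]/m = K by the homogeneous maximal ideal
   m = (t^s | s in S, s > 0); [sgaug_ker] identifies its kernel. *)
Definition sgaug (f : sgring) : K := (sgval f)`_0.

Fact sgaug_is_additive : zmod_morphism sgaug.
Proof. by move=> f g; rewrite /sgaug /= coefB. Qed.

Fact sgaug_is_multiplicative : monoid_morphism sgaug.
Proof. by split=> [|f g]; rewrite /sgaug /= ?coef1 // coef0M. Qed.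

HB.instance Definition _ := GRing.isZmodMorphism.Build sgring K sgaug
  sgaug_is_additive.
HB.instance Definition _ := GRing.isMonoidMorphism.Build sgring K sgaug
  sgaug_is_multiplicative.

Lemma sgaug_ker (f : sgring) : sgaug f = 0 <->
  exists2 l : seq (sgring * nat),
    all (fun p => S p.2 && (0 < p.2)%N) l &
    sgval f = \sum_(p <- l) sgval p.1 * 'X^(p.2).
Proof.
split=> [f0|[l Sl]]; last first.
  rewrite /sgaug => ->; rewrite coef_sum big_seq big1 // => p /(allP Sl)/andP[_].
  by rewrite coefMXn => ->.
have SC (c : K) : c%:P \in sgpoly.
  apply/sgpolyP=> i; rewrite coefC; case: (i =P 0%N) => [->|_].
    by rewrite submon0.
  by rewrite eqxx.
pose s := [seq i <- iota 0 (size (sgval f)) | (sgval f)`_i != 0].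
exists [seq (SgRing (SC (sgval f)`_i), i) | i <- s].
  apply/allP=> q /mapP[i]; rewrite mem_filter => /andP[fi _] -> /=.
  apply/andP; split; first by have /sgpolyP := valP f; apply.
  by case: i fi => //; rewrite -/(sgaug f) f0 eqxx.
rewrite big_map big_filter /= -[LHS]coefK poly_def.
rewrite -(big_mkord xpredT (fun i => (sgval f)`_i *: 'X^i)) /index_iota subn0.
rewrite (bigID (fun i => (sgval f)`_i != 0)) /= [X in _ + X]big1 ?addr0.
  by apply: eq_bigr => i _; rewrite mul_polyC.
by move=> i; rewrite negbK => /eqP->; rewrite scale0r.
Qed.

End SemigroupRing.

(** ** Free resolutions and Tor *)

(* The field K as an R-module, through eps : R -> K. *)
Definition scalar_module (R : comNzRingType) (K : fieldType)
  (eps : {rmorphism R -> K}) : Type := K.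

Section ScalarModule.
Variables (R : comNzRingType) (K : fieldType) (eps : {rmorphism R -> K}).

HB.instance Definition _ := GRing.Zmodule.on (scalar_module eps).

Definition scalar_module_scale (a : R) (x : scalar_module eps) :
  scalar_module eps := eps a * x.

Fact scalar_module_scaleA a b x :
  scalar_module_scale a (scalar_module_scale b x) =
  scalar_module_scale (a * b) x.
Proof. by rewrite /scalar_module_scale mulrA rmorphM. Qed.

Fact scalar_module_scale1 : left_id 1 scalar_module_scale.
Proof. by move=> x; rewrite /scalar_module_scale rmorph1 mul1r. Qed.

Fact scalar_module_scaleDr : right_distributive scalar_module_scale +%R.
Proof. by move=> a x y; rewrite /scalar_module_scale mulrDr. Qed.

Fact scalar_module_scaleDl x :
  {morph scalar_module_scale^~ x : a b / a + b >-> a + b}.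
Proof. by move=> a b; rewrite /scalar_module_scale rmorphD mulrDl. Qed.

HB.instance Definition _ := GRing.Zmodule_isLmodule.Build R (scalar_module eps)
  scalar_module_scaleA scalar_module_scale1 scalar_module_scaleDr
  scalar_module_scaleDl.

End ScalarModule.

(* A resolution ... -> R^(r 2) -> R^(r 1) -> R^(r 0) -> M -> 0 by free modules
   of finite rank; elements of R^(r i) are row vectors, and the i-th
   differential R^(r i.+1) -> R^(r i) is right multiplication by [res_d i]. *)
Record free_resolution (R : comNzRingType) (M : lmodType R) := FreeResolution {
  res_rank : nat -> nat;
  res_d : forall i, 'M[R]_(res_rank i.+1, res_rank i);
  res_aug : {linear 'rV[R]_(res_rank 0) -> M};
  res_aug_surj : forall x : M, exists v, res_aug v = x;
  res_exact0 : forall v : 'rV[R]_(res_rank 0),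
    res_aug v = 0 <-> exists w, w *m res_d 0 = v;
  res_exactS : forall i (v : 'rV[R]_(res_rank i.+1)),
    v *m res_d i = 0 <-> exists w, w *m res_d i.+1 = v }.

Section Tor.
Variables (R : comNzRingType) (K : fieldType) (eps : {rmorphism R -> K}).
Variables (M : lmodType R) (F : free_resolution M).

(* The complex F (x)_R K: base change along eps turns R^r into K^r and applies
   eps to the entries of the differentials. *)
Definition tensor_d i : 'M[K]_(res_rank F i.+1, res_rank F i) :=
  map_mx eps (res_d F i).

(* dim_K H_i(F (x)_R K) = dim (i-cycles) - dim (i-boundaries). The truncated
   subtraction is harmless, as boundaries are cycles. *)
Definition tor_dim (i : nat) : nat :=
  match i with
  | 0 => (res_rank F 0 - \rank (tensor_d 0))%N
  | j.+1 => (\rank (kermx (tensor_d j)) - \rank (tensor_d j.+1))%N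
  end.

End Tor.

(* beta i = dim_K Tor_i^R(K, K) for all i, K being an R-module through eps.
   Tor is computed by a free resolution of K; it is required both that there is
   one and that the answer is beta i for each of them. *)
Definition betti_numbers (R : comNzRingType) (K : fieldType)
    (eps : {rmorphism R -> K}) (beta : nat -> nat) : Prop :=
  inhabited (free_resolution (scalar_module eps)) /\
  forall (F : free_resolution (scalar_module eps)) i, tor_dim eps F i = beta i.

(** ** Formal power series, as sequences of coefficients *)

Definition fps (A : Type) : Type := nat -> A.

Definition fps_of_poly (A : nzRingType) (p : {poly A}) : fps A := fun i => p`_i.

Section FormalPowerSeries.
Variable A : comUnitRingType.
Implicit Types a b c : fps A.

Definition fps_mul a b : fps A := fun n => \sum_(k < n.+1) a k * b (n - k)%N.

(* The first n coefficients of a / b, by long division. *)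
Fixpoint fps_div_seq a b (n : nat) : seq A :=
  if n is n'.+1 then
    let s := fps_div_seq a b n' in
    rcons s ((a n' - \sum_(k < n') s`_k * b (n' - k)%N) / b 0%N)
  else [::].

Definition fps_div a b : fps A := fun n => (fps_div_seq a b n.+1)`_n.

Lemma size_fps_div_seq a b n : size (fps_div_seq a b n) = n.
Proof. by elim: n => //= n IHn; rewrite size_rcons IHn. Qed.

Lemma nth_fps_div_seq a b n k : (k < n)%N ->
  (fps_div_seq a b n)`_k = fps_div a b k.
Proof.
elim: n => // n IHn; rewrite ltnS leq_eqVlt => /predU1P[->//|lt_kn].
by rewrite /= nth_rcons size_fps_div_seq lt_kn IHn.
Qed.

Lemma fps_divK a b : b 0%N \is a GRing.unit -> fps_mul (fps_div a b) b =1 a.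
Proof.
move=> ub n; rewrite /fps_mul big_ord_recr /= subnn {2}/fps_div /=.
rewrite nth_rcons size_fps_div_seq ltnn eqxx divrK //.
under [X in _ - X]eq_bigr => k _ do rewrite nth_fps_div_seq //.
by rewrite addrC subrK.
Qed.

Lemma fps_div_uniq a b c : b 0%N \is a GRing.unit ->
  fps_mul c b =1 a -> c =1 fps_div a b.
Proof.
move=> ub cb; elim/ltn_ind => n IHn.
move: (fps_divK a ub n); rewrite -cb /fps_mul !big_ord_recr /= subnn.
rewrite (eq_bigr (fun k : 'I_n => c k * b (n - k)%N)); last first.
  by move=> k _; rewrite -IHn.
by move/addrI/(mulIr ub).
Qed.

End FormalPowerSeries.

(* Main.v *)
From HB Require Import structures.
Require Import Defs.
From mathcomp Require Import all_boot all_order all_algebra.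
From mathcomp Require Import boolp zify ring.

Set Implicit Arguments.
Unset Strict Implicit.
Unset Printing Implicit Defensive.

Import GRing.Theory.
Local Open Scope ring_scope.

(* The residue field has a minimal free resolution that can be described by
   leading coefficients. A submodule N of R^r is filtered by the ordered
   coordinates, and at each coordinate the last nonzero entries of elements of N
   form an ideal; here this ideal is always 0, the maximal ideal M, or the ideal
   I spanned by the t^s with s <> 0, m + n - 1. Listing generators t^(m+i) in
   increasing order, the successive colon ideals are 0 for t^m, then I for
   t^(m+1), because t^(m+1) t^(m+n-1) = t^(2m+n) is not a multiple of t^m, and M
   for all the others, because t^(m+1) t^(m+n-1) is already available. So the
   first syzygies of N are of the same kind, and the numbers a of M's and b of
   I's follow a' = (m-3) a + (m-4) b, b' = a + b, with (m-1) a + (m-2) b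
   generators. The lifts can be taken with entries in M because every t^s with
   s >= 2m lies in M I. *)

(** The invariant [Q] keeps every stage extendable, and [T] depends on [i] because the matrices to
    be chosen change size with the degree. *)
Lemma dependent_choice_nat (T : nat -> Type) (Q : forall i, T i -> Prop)
    (P : forall i, T i -> T i.+1 -> Prop) (x0 : T 0%N) :
  Q 0%N x0 ->
  (forall i x, Q i x -> exists2 y, P i x y & Q i.+1 y) ->
  exists2 f : forall i, T i, f 0%N = x0 & forall i, P i (f i) (f i.+1).
Proof.
move=> Q0 QS.
pose next i (s : {x : T i | Q i x}) : {y : T i.+1 | Q i.+1 y} :=
  let: exist2 y _ Qy := cid2 (QS i (sval s) (svalP s)) in exist _ y Qy.
pose F := nat_rect (fun i => {x : T i | Q i x}) (exist _ x0 Q0) next.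
exists (fun i => sval (F i)) => // i.
by rewrite /= /next; case: cid2.
Qed.

Lemma matrix_of_rows (R : pzRingType) p q (P : 'I_p -> 'rV[R]_q -> Prop) :
  (forall i, exists v, P i v) ->
  exists A : 'M[R]_(p, q), forall i, P i (row i A).
Proof.
move=> /choice[f Pf]; exists (\matrix_i f i) => i.
by rewrite rowK.
Qed.

(** * Comparison of free resolutions: chain maps and homotopies *)

Section Comparison.
Variables (R : comNzRingType) (M : lmodType R).
Implicit Types F G : free_resolution M.

(** The augmentation serves as the differential out of degree 0, so that exactness has one form in
    all degrees. *)
Definition res_cycle F i : 'rV[R]_(res_rank F i) -> Prop :=
  match i with
  | 0 => fun v => res_aug F v = 0
  | j.+1 => fun v => v *m res_d F j = 0
  end.

Lemma res_exact F i (v : 'rV[R]_(res_rank F i)) :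
  res_cycle v <-> exists w, w *m res_d F i = v.
Proof. by case: i v => [|i] v; [apply: res_exact0 | apply: res_exactS]. Qed.

Lemma res_lift_rows F i p (A : 'M[R]_(p, res_rank F i)) :
  (forall k, res_cycle (row k A)) -> exists B, B *m res_d F i = A.
Proof.
move=> cA; have [B BA] := matrix_of_rows (fun k => (res_exact _).1 (cA k)).
by exists B; apply/row_matrixP => k; rewrite row_mul.
Qed.

Lemma res_dd F i : res_d F i.+1 *m res_d F i = 0.
Proof.
apply/row_matrixP => k; rewrite row_mul row0; apply/(@res_exactS _ _ F).
by exists (delta_mx 0 k); rewrite rowE.
Qed.

Definition chain_map F G (f : forall i, 'M[R]_(res_rank F i, res_rank G i)) :=
  forall i, f i.+1 *m res_d G i = res_d F i *m f i.

(** Rows are lifted one degree at a time: the matrix built so far sends cycles to cycles, and cycles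
    of [G] are boundaries. *)
Lemma chain_lift F G : exists2 f, @chain_map F G f &
  forall v, res_aug G (v *m f 0%N) = res_aug F v.
Proof.
have [f0 f0P] := matrix_of_rows
  (fun k => res_aug_surj G (res_aug F (delta_mx 0 k))).
have augf0 v : res_aug G (v *m f0) = res_aug F v.
  rewrite {2}(row_sum_delta v) mulmx_sum_row !linear_sum /=.
  by apply: eq_bigr => k _; rewrite !linearZ f0P.
pose Q i (f : 'M[R]_(res_rank F i, res_rank G i)) :=
  forall v, res_cycle v -> res_cycle (v *m f).
have Q0 : Q 0%N f0 by move=> v /= v0; rewrite augf0.
have QS i f : Q i f ->
    exists2 f', f' *m res_d G i = res_d F i *m f & Q i.+1 f'.
  move=> Qf; have [|f' f'P] := @res_lift_rows G i _ (res_d F i *m f).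
    move=> k; rewrite row_mul; apply/Qf/res_exact.
    by exists (delta_mx 0 k); rewrite rowE.
  by exists f' => // v /= v0; rewrite -mulmxA f'P mulmxA v0 mul0mx.
have [f ff0 fP] := dependent_choice_nat Q0 QS.
by exists f => // v; rewrite ff0.
Qed.

(** The rows of [f i.+1 - res_d F i *m h i] are cycles by the homotopy equation one degree lower, so
    exactness of [G] lifts them. *)
Lemma null_homotopy F G f : @chain_map F G f ->
  (forall v, res_aug G (v *m f 0%N) = 0) ->
  exists2 h : forall i, 'M[R]_(res_rank F i, res_rank G i.+1),
    h 0%N *m res_d G 0 = f 0%N &
    forall i, h i.+1 *m res_d G i.+1 = f i.+1 - res_d F i *m h i.
Proof.
move=> fP f0.
have [k|h0 h0P] := @res_lift_rows G 0 _ (f 0%N); first by rewrite rowE /= f0.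
pose Q i (h : 'M[R]_(res_rank F i, res_rank G i.+1)) :=
  res_d F i *m (f i - h *m res_d G i) = 0.
have Q0 : Q 0%N h0 by rewrite /Q h0P subrr mulmx0.
have QS i h : Q i h ->
    exists2 h', h' *m res_d G i.+1 = f i.+1 - res_d F i *m h & Q i.+1 h'.
  move=> Qh; have [k|h' h'P] :=
    @res_lift_rows G i.+1 _ (f i.+1 - res_d F i *m h).
    by rewrite /= -row_mul mulmxBl fP -mulmxA -mulmxBr Qh row0.
  by exists h' => //; rewrite /Q h'P opprB addrC subrK mulmxA res_dd mul0mx.
have [h hh0 hP] := dependent_choice_nat Q0 QS.
by exists h => //; rewrite hh0.
Qed.

End Comparison.

(** * Independence of Tor from the resolution *)

(** Up to boundaries, [f] followed by [g] is the identity on cycles, so the homology of the first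
    complex is spanned by the image under [g] of that of the second. *)
Lemma homology_dim_le (K : fieldType) p q q' r s s'
    (A : 'M[K]_(p, q)) (A' : 'M[K]_(q, q')) (B : 'M[K]_(r, s))
    (B' : 'M[K]_(s, s')) (f : 'M[K]_(q, s)) (g : 'M[K]_(s, q))
    (f' : 'M[K]_(q', s')) (g' : 'M[K]_(r, p))
    (h : 'M[K]_(q, p)) (h' : 'M[K]_(q', q)) :
  f *m B' = A' *m f' -> g' *m A = B *m g -> B *m B' = 0 ->
  f *m g - 1%:M = A' *m h' + h *m A ->
  (\rank (kermx A') - \rank A <= \rank (kermx B') - \rank B)%N.
Proof.
move=> fP gP BB hP.
pose C := (kermx B' :\: B)%MS.
have BkB : (B <= kermx B')%MS by apply/sub_kermxP.
have rC : (\rank C = \rank (kermx B') - \rank B)%N.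
  by rewrite -(mxrank_cap_compl (kermx B') B) (capmx_idPr BkB) addKn.
have CB : (kermx B' <= C + B)%MS.
  by rewrite -(addsmx_diff_cap_eq (kermx B') B) addsmxS ?capmxSr.
rewrite leq_subLR -rC addnC.
have sub : (kermx A' <= C *m g + A)%MS.
  have kA := mulmx_ker A'; move: (kermx A') kA => k kA.
  have -> : k = k *m f *m g - k *m h *m A.
    have fg : f *m g = A' *m h' + h *m A + 1%:M by rewrite -hP subrK.
    rewrite -!mulmxA -mulmxBr fg [A' *m h' + _ + _]addrAC.
    by rewrite addrK mulmxDr mulmx1 mulmxA kA mul0mx add0r.
  rewrite addmx_sub //; last first.
    by rewrite -mulNmx (submx_trans (submxMl _ _)) ?addsmxSr.
  have kB : (k *m f <= C + B)%MS.
    apply: submx_trans CB; apply/sub_kermxP.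
    by rewrite -mulmxA fP mulmxA kA mul0mx.
  apply: submx_trans (submxMr g kB) _; rewrite addsmxMr addsmxS //.
  by rewrite -gP submxMl.
apply: leq_trans (mxrankS sub) _; apply: leq_trans (mxrank_adds_leqif _ _) _.
by rewrite leq_add2r mxrankM_maxl.
Qed.

Section TorInvariance.
Variables (R : comNzRingType) (K : fieldType) (eps : {rmorphism R -> K}).
Variables (M : lmodType R).
Implicit Types F G : free_resolution M.

(** Lifts of the identity in both directions compose to a map homotopic to the identity, and base
    change along [eps] keeps these matrix identities. *)
Lemma tor_dim_le F G i : (tor_dim eps F i <= tor_dim eps G i)%N.
Proof.
have [f fP f0] := chain_lift F G; have [g gP g0] := chain_lift G F.
pose e i := f i *m g i - 1%:M.
have eP : chain_map e.
  move=> j; rewrite /e mulmxBl mul1mx mulmxBr mulmx1 -mulmxA gP mulmxA fP.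
  by rewrite -mulmxA.
have [|h h0 hP] := null_homotopy eP.
  by move=> v; rewrite mulmxBr mulmx1 mulmxA linearB /= g0 f0 subrr.
have toK p q (A B : 'M[R]_(p, q)) : A = B -> map_mx eps A = map_mx eps B.
  by move->.
case: i => [|i] /=; rewrite /tensor_d.
  (* In degree 0 every vector is a cycle; writing the space as the kernel of a map to a zero space
     gives this degree the shape of the others. *)
  have ker0 q : \rank (kermx (0 : 'M[K]_(q, 0))) = q.
    by rewrite mxrank_ker mxrank0 subn0.
  rewrite -[X in (X - _ <= _)%N]ker0 -[X in (_ <= X - _)%N]ker0.
  apply: (@homology_dim_le _ _ _ _ _ _ _ _ _ _ _ (map_mx eps (f 0%N))
    (map_mx eps (g 0%N)) 0 (map_mx eps (g 1%N)) (map_mx eps (h 0%N)) 0).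
  - by rewrite mulmx0 mul0mx.
  - by rewrite -!map_mxM gP.
  - by rewrite mulmx0.
  - by rewrite mul0mx add0r -!map_mxM h0 /e map_mxB map_mx1.
apply: (@homology_dim_le _ _ _ _ _ _ _ _ _ _ _ (map_mx eps (f i.+1))
  (map_mx eps (g i.+1)) (map_mx eps (f i)) (map_mx eps (g i.+2))
  (map_mx eps (h i.+1)) (map_mx eps (h i))).
- by rewrite -!map_mxM fP.
- by rewrite -!map_mxM gP.
- by rewrite -map_mxM res_dd map_mx0.
- by rewrite -!map_mxM hP -map_mxD subrKC /e map_mxB map_mx1.
Qed.

Lemma tor_dim_unique F G : tor_dim eps F =1 tor_dim eps G.
Proof. by move=> i; apply/eqP; rewrite eqn_leq !tor_dim_le. Qed.

Lemma tor_dim_minimal F : (forall i, map_mx eps (res_d F i) = 0) ->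
  tor_dim eps F =1 res_rank F.
Proof.
by move=> F0 [|i] /=; rewrite /tensor_d !F0 ?mxrank_ker ?mxrank0 !subn0.
Qed.

End TorInvariance.

(** * The semigroup, its ring and the ideals M and I *)

Lemma lex_ltn m a b i j : (i < m)%N -> (a < b)%N -> (a * m + i < b * m + j)%N.
Proof. by move=> im ab; nia. Qed.

Lemma lex_leq m a b i j : (j < m)%N -> (a * m + i < b * m + j)%N -> (a <= b)%N.
Proof. by move=> jm; apply: contraLR; rewrite -!ltnNge ltnS => ba; nia. Qed.

(** Two or more generators sum to at least 2m, and from 2m on there are no gaps. *)
Lemma GammaE m n k : (3 <= n)%N -> (n < m)%N ->
  Gamma m n k = (k == 0)%N || ((m <= k)%N && (k != m + n)%N).
Proof.
move=> n3 nm; apply/idP/idP.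
  move=> /asboolP[[|a [|b s]]] /=; first by move=> _ <-.
    by rewrite addn0 andbT => /andP[A1 A2] <-; lia.
  by move=> /and3P[/andP[A1 A2] /andP[B1 B2] _] <-; lia.
case/orP => [/eqP->|kP]; first exact: submon0.
have [k2|k2] := leqP (2 * m) k; first exact: Gamma_cofinite.
by apply/asboolP; exists [:: k]; rewrite /= ?addn0 // andbT; lia.
Qed.

#[local] Arguments submon_mem : simpl never.

Section Ideals.
Variables (K : fieldType) (m n : nat).
Hypotheses (hn : (3 <= n)%N) (hm : (n < m)%N).
Local Notation R := (sgring K (Gamma m n)).
Local Notation co f j := (polyseq (sgval f))`_j.

(** The value is the default 0 when [s] is a gap. *)
Definition sgmon (s : nat) : R := insubd 0 'X^s.

Definition sgconst (a : K) : R := insubd 0 a%:P.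

Lemma val_sgmon (s : nat) : Gamma m n s -> sgval (sgmon s) = 'X^s.
Proof.
move=> Ss; rewrite /sgmon; apply: insubdK; apply/sgpolyP => i.
by rewrite coefXn; case: (i =P s) => [-> //|_]; rewrite eqxx.
Qed.

Lemma val_sgconst a : sgval (sgconst a) = a%:P.
Proof.
rewrite /sgconst; apply: insubdK; apply/sgpolyP => i.
by rewrite coefC; case: (i =P 0%N) => [-> _|]; rewrite ?eqxx ?submon0.
Qed.

Lemma coef_gap (f : R) j : ~~ Gamma m n j -> co f j = 0.
Proof. by have /sgpolyP Sf := valP f; move=> /(contraNeq (Sf j)). Qed.

Lemma sgval_sum I (r : seq I) P (F : I -> R) :
  sgval (\sum_(i <- r | P i) F i) = \sum_(i <- r | P i) sgval (F i).
Proof. exact: (raddf_sum (val : R -> {poly K})). Qed.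

Lemma sgvalM (f g : R) : sgval (f * g) = sgval f * sgval g.
Proof. by []. Qed.

(* Labels of ideals: [None] is 0, [Some true] is M and [Some false] is I. *)
Definition gens (l : option bool) (i : nat) : bool :=
  if l is Some b then (i != n) && (b || (i != n.-1)) else false.

Definition ideal (l : option bool) (f : R) : Prop :=
  if l is Some b then co f 0 = 0 /\ (b \/ co f (m + n.-1)%N = 0) else f = 0.

(* The label of the colon ideal (t^(m+i'), i' < i) : t^(m+i). *)
Definition colon_label (i : nat) : option bool :=
  match i with 0 => None | 1 => Some false | _ => Some true end.

Definition in_max (f : R) : Prop := co f 0 = 0.
Definition in_high (f : R) : Prop := forall j, (j < 2 * m)%N -> co f j = 0.

Lemma gens_Gamma l i : gens l i -> Gamma m n (m + i)%N.
Proof. by case: l => //= b; rewrite GammaE // => /andP[]; lia. Qed.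

Lemma in_max0 : in_max 0. Proof. exact: coef0. Qed.
Lemma in_maxD f g : in_max f -> in_max g -> in_max (f + g).
Proof. by rewrite /in_max /= coefD => -> ->; rewrite addr0. Qed.
Lemma in_maxN f : in_max f -> in_max (- f).
Proof. by rewrite /in_max /= coefN => ->; rewrite oppr0. Qed.

Lemma in_max_low f j : in_max f -> (j < m)%N -> co f j = 0.
Proof.
move=> f0 jm; have [->//|j0] := eqVneq j 0%N.
by apply: coef_gap; rewrite GammaE //; lia.
Qed.

Lemma in_highD f g : in_high f -> in_high g -> in_high (f + g).
Proof. by move=> f0 g0 j jm; rewrite /= coefD f0 // g0 // addr0. Qed.
Lemma in_highN f : in_high f -> in_high (- f).
Proof. by move=> f0 j jm; rewrite /= coefN f0 // oppr0. Qed.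
Lemma in_high_sum I (r : seq I) (P : pred I) (F : I -> R) :
  (forall i, P i -> in_high (F i)) -> in_high (\sum_(i <- r | P i) F i).
Proof.
move=> Fh; apply: (big_ind in_high) => //; last exact: in_highD.
by move=> j _; rewrite coef0.
Qed.

Lemma in_highM f g : in_max f -> in_max g -> in_high (f * g).
Proof.
move=> f0 g0 j jm; rewrite /= coefM big1 // => i _.
have [im|im] := ltnP i m; first by rewrite (in_max_low f0) ?mul0r.
by rewrite (in_max_low g0) ?mulr0 //; lia.
Qed.

Lemma in_max_sgmon (s : nat) : Gamma m n s -> (0 < s)%N -> in_max (sgmon s).
Proof. by move=> Ss s0; rewrite /in_max val_sgmon // coefXn; case: s Ss s0. Qed.

Lemma sgmonM a b c d : (a + b = c + d)%N ->
  Gamma m n a -> Gamma m n b -> Gamma m n c -> Gamma m n d ->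
  sgmon a * sgmon b = sgmon c * sgmon d.
Proof.
move=> e Sa Sb Sc Sd; apply: val_inj.
by rewrite /= !val_sgmon // -!exprD e.
Qed.

Lemma m_gt0 : (0 < m)%N. Proof. lia. Qed.
Lemma m_gt1 : (1 < m)%N. Proof. lia. Qed.
Definition ord_m0 : 'I_m := Ordinal m_gt0.
Definition ord_m1 : 'I_m := Ordinal m_gt1.

Lemma sum_at (i0 : 'I_m) (c : R) (F : 'I_m -> R) :
  \sum_i (if i == i0 then c else 0) * F i = c * F i0.
Proof.
rewrite (bigD1 i0) //= eqxx big1 ?addr0 // => i /negbTE->.
by rewrite mul0r.
Qed.

(* Every exponent j >= 2m lies in m + S, except 2m + n = (m+1) + (m+n-1). *)
Lemma ideal_gen l f (b : bool) : ideal l f -> (b -> in_high f) ->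
  exists c : 'I_m -> R, [/\ forall i : 'I_m, ~~ gens l i -> c i = 0,
    b -> forall i, in_max (c i) & f = \sum_i c i * sgmon (m + i)%N].
Proof.
case: l => [b'|] /=; last first.
  move=> -> _; exists (fun=> 0); split => //.
    by move=> _ i; apply: in_max0.
  by rewrite big1 // => i; rewrite mul0r.
move=> [f0 fI] fh.
(* [p0] is the quotient by t^m of the terms of [f] of exponent at least 2m, except 2m+n; that
   exponent is left to the generator t^(m+1), through [c1]. *)
pose p0 : {poly K} := \poly_(j < size (sgval f))
  (if (m <= j)%N && (j != m + n)%N then co f (m + j)%N else 0).
have p0S : p0 \in sgpoly (Gamma m n).
  apply/sgpolyP => i; rewrite coef_poly; case: ifP => _; last by rewrite eqxx.
  by case: ifP => [iP _|]; [rewrite GammaE // iP orbT | rewrite eqxx].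
have cop0 j :
    p0`_j = if (m <= j)%N && (j != m + n)%N then co f (m + j)%N else 0.
  rewrite coef_poly; case: ltnP => // jf; case: ifP => // _.
  by rewrite nth_default // (leq_trans jf) ?leq_addl.
pose c0 : R := SgRing p0S.
pose c1 : R := sgconst (co f (m + m + n)%N) * sgmon (m + n.-1)%N.
have Sn1 : Gamma m n (m + n.-1)%N by rewrite GammaE //; lia.
have Sm : Gamma m n m by rewrite GammaE //; lia.
have Sm1 : Gamma m n (m + 1)%N by rewrite GammaE //; lia.
pose c (i : 'I_m) := sgconst (co f (m + i)%N) + (if i == ord_m0 then c0 else 0)
            + (if i == ord_m1 then c1 else 0).
exists c; split.
- move=> i; rewrite negb_and !negbK negb_or negbK => gi.
  have fi0 : co f (m + i)%N = 0.
    case/orP: gi => [/eqP->|/andP[b'0 /eqP->]].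
      by apply: coef_gap; rewrite GammaE //; lia.
    by case: fI => // b'1; rewrite b'1 in b'0.
  (* Since n is at least 3, the excluded indices n and n-1 differ from 0 and 1, which carry [c0] and
     [c1]. *)
  have /negbTE i0 : i != ord_m0 by rewrite -val_eqE /=; lia.
  have /negbTE i1 : i != ord_m1 by rewrite -val_eqE /=; lia.
  by rewrite /c fi0 i0 i1 !addr0; apply: val_inj; rewrite /= val_sgconst.
- move=> bT i; rewrite /c; apply: in_maxD; first apply: in_maxD.
  + by rewrite /in_max val_sgconst coefC /= (fh bT) //; have := ltn_ord i; lia.
  + by case: ifP => _; rewrite /in_max ?coef0 //= cop0; case: ifP => //; lia.
  + case: ifP => _; rewrite /in_max ?coef0 // sgvalM val_sgmon //.
    by rewrite coefMXn; case: ifP => //; lia.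
under eq_bigr do rewrite /c !mulrDl.
rewrite !big_split /= !sum_at /= addn0.
apply: val_inj => /=; rewrite sgval_sum.
have -> : \sum_(i < m) sgval (sgconst (co f (m + i)%N) * sgmon (m + i)%N) =
    (\poly_(i < m) co f (m + i)%N) * 'X^m.
  rewrite poly_def big_distrl /=; apply: eq_bigr => i _.
  have [Si|nSi] := boolP (Gamma m n (m + i)%N); last first.
    by rewrite val_sgconst coef_gap // scale0r !mul0r.
  by rewrite val_sgconst val_sgmon // mul_polyC -scalerAl -exprD addnC.
rewrite !val_sgmon // val_sgconst; apply/polyP => j.
rewrite !coefD -[_%:P * _ * _]mulrA -exprD coefCM !coefMXn coefXn coef_poly.
rewrite cop0.
have [jm|jm] := ltnP j m.
  rewrite in_max_low // add0r; case: eqP => [|_]; first lia.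
  by rewrite mulr0 addr0.
rewrite subnKC //.
have [->|jn] := eqVneq j (m + n.-1 + (m + 1))%N.
  have -> : (m + n.-1 + (m + 1) = m + m + n)%N by lia.
  have -> : (m + m + n - m = m + n)%N by lia.
  by rewrite eqxx andbF addr0 mulr1; case: ifP => [|_]; [lia | rewrite add0r].
rewrite mulr0 addr0.
have [j2|j2] := ltnP (j - m) m.
  by rewrite addr0.
by rewrite /= add0r; case: eqP => // ?; lia.
Qed.

(** * Syzygies of the monomials t^(m+i) *)

Lemma syzygy_lead (c : 'I_m -> R) (i0 : 'I_m) :
  (forall i : 'I_m, (i0 < i)%N -> c i = 0) ->
  (forall i : 'I_m, i = n :> nat -> c i = 0) ->
  \sum_i c i * sgmon (m + i)%N = 0 -> ideal (colon_label i0) (c i0).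
Proof.
move=> ci0 cn0 cs.
have coE j : \sum_(i < m) (if (j < i)%N then 0 else co (c i) (j - i)%N) = 0.
  have := congr1 (fun f : R => co f (m + j)%N) cs.
  rewrite sgval_sum coef_sum coef0 => e; rewrite -[RHS]e; apply: eq_bigr => i _.
  have [ein|ni] := eqVneq (i : nat) n.
    by rewrite cn0 // mul0r coef0 if_same coef0.
  rewrite sgvalM val_sgmon; last by rewrite GammaE //; lia.
  by rewrite coefMXn ltn_add2l subnDl.
have lead j : (0 < j)%N -> forall i : 'I_m, (i < j)%N -> (j < m)%N ->
    co (c i) (j - i)%N = 0.
  by move=> j0 i ij jm; apply: coef_gap; rewrite GammaE //; lia.
(* The coefficient of t^(m+i0) sees only the constant term of [c i0]: any other [c i] would
   contribute at an exponent strictly between 0 and m, which is a gap. *)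
have aug0 : in_max (c i0).
  have := coE i0; rewrite (bigD1 i0) //= ltnn subnn big1 ?addr0 // => i ii0.
  case: ltnP => // ile; apply: lead; have := ltn_ord i0.
  - by move: ii0; rewrite -val_eqE /=; lia.
  - by move: ii0; rewrite -val_eqE /=; lia.
  - by [].
case: i0 ci0 aug0 {lead} => [[|[|i0]] i0m] ci0 aug0 /=; last by split; [|left].
  apply: val_inj => /=; apply/polyP => j; rewrite coef0.
  have := coE j; rewrite (bigD1 (Ordinal i0m)) //= subn0 big1 ?addr0 // => i.
  by rewrite -val_eqE /= -lt0n => i0; rewrite ci0 //= coef0 if_same.
split => //; right.
(* At t^(2m+n) the entry of index 0 contributes its coefficient at the gap m+n, which isolates the
   coefficient of t^(m+n-1) in the entry of index 1. *)
have := coE (m + n)%N; rewrite (bigD1 (Ordinal i0m)) //= ltnNge.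
have -> : (1 <= m + n)%N by lia.
have -> /= : (m + n - 1 = m + n.-1)%N by lia.
rewrite big1 ?addr0 // => i; rewrite -val_eqE /= => i1; case: ltnP => // _.
have [ei|i2] := eqVneq (i : nat) 0%N.
  by rewrite ei subn0; apply: coef_gap; rewrite GammaE //; lia.
by rewrite ci0 /= ?coef0 //; lia.
Qed.

(** A two-term relation suffices: t^(m+i0) t^(m+i') is also a multiple of t^m, or of t^(m+1) when i0
    + i' = n, with cofactor in M. *)
Lemma syzygy_lift l (i0 i' : 'I_m) : gens l i0 -> gens (colon_label i0) i' ->
  exists c : 'I_m -> R, [/\ forall i : 'I_m, ~~ gens l i -> c i = 0,
    forall i : 'I_m, (i0 < i)%N -> c i = 0, forall i, in_max (c i),
    c i0 = sgmon (m + i')%N & \sum_i c i * sgmon (m + i)%N = 0].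
Proof.
move=> gi0 gi'.
have i0gt0 : (0 < i0)%N by case: (i0 : nat) gi'.
have i'n : (i' != n :> nat) by move: gi'; case: colon_label => //= b /andP[].
have lgens j : (j <= 1)%N -> gens l j.
  by case: l gi0 => //= b _ j1; apply/andP; split; [|apply/orP; right]; lia.
have Si' : Gamma m n (m + i')%N by rewrite GammaE //; lia.
have Si0 := gens_Gamma gi0.
(* Here t^(m+i0) t^(m+i') is a multiple of the generator t^(m+k). *)
have build (k : 'I_m) s :
    (k < i0)%N -> (k <= 1)%N -> Gamma m n s -> (0 < s)%N ->
    (m + i' + (m + i0) = s + (m + k))%N -> exists c : 'I_m -> R,
    [/\ forall i : 'I_m, ~~ gens l i -> c i = 0,
    forall i : 'I_m, (i0 < i)%N -> c i = 0, forall i, in_max (c i),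
    c i0 = sgmon (m + i')%N & \sum_i c i * sgmon (m + i)%N = 0].
  move=> ki0 k1 Ss s0 e.
  have kn : (i0 == k) = false by rewrite -val_eqE /=; lia.
  exists (fun i => (if i == i0 then sgmon (m + i')%N else 0)
                 + (if i == k then - sgmon s else 0)); split.
  - move=> i gi; have /negbTE-> : i != i0 by apply: contraNneq gi => ->.
    have /negbTE-> : i != k by apply: contraNneq gi => ->; apply: lgens.
    by rewrite addr0.
  - move=> i ii0; rewrite -!val_eqE /=.
    by do 2![case: eqP => [|_]; first lia]; rewrite addr0.
  - move=> i; apply: in_maxD; case: ifP => _; try exact: in_max0.
      by apply: in_max_sgmon => //; lia.
    by apply/in_maxN/in_max_sgmon.
  - by rewrite eqxx kn addr0.
  under eq_bigr do rewrite mulrDl.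
  rewrite big_split /= !sum_at mulNr (sgmonM e) ?subrr //.
  exact/gens_Gamma/lgens.
have [e|ne] := eqVneq (i0 + i')%N n; last first.
  by apply: (build ord_m0 (m + i0 + i')%N) => //=; rewrite ?GammaE //; lia.
(* For i0 = 1 this case would force i' = n-1, which label I excludes; hence t^(m+1) comes strictly
   before t^(m+i0). *)
have i02 : (1 < i0)%N.
  rewrite ltn_neqAle i0gt0 andbT; apply/eqP => i01.
  by move: gi'; rewrite -i01 /= => /andP[_]; lia.
by apply: (build ord_m1 (m + n.-1)%N) => //=; rewrite ?GammaE //; lia.
Qed.

(** * Submodules of free modules with prescribed leading ideals *)

(* The coordinates of R^rk are ordered by the values of [ht]. *)
Record shape := Shape {
  rk : nat; ht : 'I_rk -> nat; lab : 'I_rk -> option bool }.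

Definition new_index (s : shape) : pred ('I_(rk s) * 'I_m) :=
  fun p => gens (lab p.1) p.2.
Arguments new_index : clear implicits.

(** As i < m, the heights order the pairs (k, i) lexicographically, so a syzygy with last entry at
    (k, i) gives at [k] a relation among the t^(m+i') with i' <= i. *)
Definition next_shape (s : shape) : shape :=
  @Shape #|new_index s|
    (fun y => ht (enum_val y).1 * m + (enum_val y).2)%N
    (fun y => colon_label (enum_val y).2).

(** [filtered_lead] bounds the leading ideals from above by the labels, [filtered_gen] from below;
    the entries of the lifts lie in M for the sake of minimality. *)
Record filtered (s : shape) (N : 'rV[R]_(rk s) -> Prop) : Prop := Filtered {
  ht_inj : injective (@ht s);
  filtered0 : N 0;
  filteredP : forall a u v, N u -> N v -> N (a *: u + v);
  filtered_lead : forall v k, N v ->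
    (forall j, (ht k < ht j)%N -> v 0 j = 0) -> ideal (lab k) (v 0 k);
  filtered_gen : forall k (i : 'I_m), gens (lab k) i ->
    exists g, [/\ N g, forall j, (ht k < ht j)%N -> g 0 j = 0,
      forall j, in_max (g 0 j) & g 0 k = sgmon (m + i)%N] }.

Lemma sum_new_index s (V : nmodType) (F : 'I_(rk s) * 'I_m -> V) :
  \sum_(p in new_index s) F p =
  \sum_k \sum_(i : 'I_m | gens (lab k) i) F (k, i).
Proof.
rewrite (pair_big_dep xpredT (fun k (i : 'I_m) => gens (lab k) i)
  (fun k i => F (k, i))) /=.
by apply: eq_big => [p|[] //].
Qed.

Lemma sum_new_index_slice s (k : 'I_(rk s)) r (c : 'I_m -> R)
    (g : 'I_(rk s) * 'I_m -> 'rV[R]_r) :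
  \sum_(p in new_index s) (if p.1 == k then c p.2 else 0) *: g p =
  \sum_(i : 'I_m | gens (lab k) i) c i *: g (k, i).
Proof.
rewrite sum_new_index (bigD1 k) //= [X in _ + X]big1 ?addr0.
  by apply: eq_bigr => i _; rewrite eqxx.
by move=> j /negbTE jk; apply: big1 => i _; rewrite jk scale0r.
Qed.

Section Step.
Variables (s : shape) (N : 'rV[R]_(rk s) -> Prop).
Hypothesis NP : filtered N.
Variable g : 'I_(rk s) * 'I_m -> 'rV[R]_(rk s).
Hypothesis gP : forall p, p \in new_index s ->
  [/\ N (g p), forall j, (ht p.1 < ht j)%N -> g p 0 j = 0,
      forall j, in_max (g p 0 j) & g p 0 p.1 = sgmon (m + p.2)%N].

Definition next_d : 'M[R]_(rk (next_shape s), rk s) :=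
  \matrix_y g (enum_val y).

Lemma filtered_sum I (r : seq I) (P : pred I) (c : I -> R)
    (v : I -> 'rV[R]_(rk s)) :
  (forall i, P i -> N (v i)) -> N (\sum_(i <- r | P i) c i *: v i).
Proof.
move=> Nv; elim/big_rec: _ => [|i x Pi Nx]; first exact: filtered0.
by apply: filteredP => //; apply: Nv.
Qed.

Lemma mul_next_d (w : 'I_(rk s) * 'I_m -> R) :
  (\row_y w (enum_val y)) *m next_d = \sum_(p in new_index s) w p *: g p.
Proof.
rewrite mulmx_sum_row [RHS]big_enum_val.
by apply: eq_bigr => y _; rewrite mxE rowK.
Qed.

Lemma slice_sub (k : 'I_(rk s)) (c : 'I_m -> R) :
  let u := \sum_(i : 'I_m | gens (lab k) i) c i *: g (k, i) in
  [/\ N u, forall j, (ht k < ht j)%N -> u 0 j = 0,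
      (forall i, in_max (c i)) -> forall j, in_high (u 0 j) &
      (forall i : 'I_m, ~~ gens (lab k) i -> c i = 0) ->
        u 0 k = \sum_i c i * sgmon (m + i)%N].
Proof.
have gk (i : 'I_m) : gens (lab k) i -> (k, i) \in new_index s by [].
split.
- by apply: filtered_sum => i /gk/gP[].
- move=> j kj; rewrite summxE big1 // => i /gk/gP[_ g0 _ _].
  by rewrite mxE g0 ?mulr0.
- move=> c0 j; rewrite summxE; apply: in_high_sum => i /gk/gP[_ _ g0 _].
  by rewrite mxE; apply: in_highM.
- move=> c0; rewrite summxE [RHS](bigID (fun i : 'I_m => gens (lab k) i)) /=.
  rewrite [X in _ = _ + X]big1 ?addr0.
    by apply: eq_bigr => i /gk/gP[_ _ _ e]; rewrite mxE e.
  by move=> i /c0->; rewrite mul0r.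
Qed.

(* With [b = true]: an element of N with entries in t^(2m)K[t] is a combination
   of the generators with coefficients in the maximal ideal; this is what keeps
   the resolution minimal. *)
Lemma filtered_decomp (b : bool) B v : N v ->
  (forall j, (B <= ht j)%N -> v 0 j = 0) ->
  (b -> forall j, in_high (v 0 j)) ->
  exists w, [/\ b -> forall p, in_max (w p),
    forall p, (B <= ht p.1)%N -> w p = 0 &
    v = \sum_(p in new_index s) w p *: g p].
Proof.
(* Division by leading entries: the entry at height [B], if there is one, is expressed by the
   monomial generators of its ideal and cancelled. *)
elim: B v => [|B IH] v Nv v0 vh.
  exists (fun=> 0); split => //; first by move=> _ p; apply: in_max0.
  rewrite big1; last by move=> p _; rewrite scale0r.
  by apply/rowP => j; rewrite v0 ?mxE.
have [/existsP[k /eqP kB]|/existsPn nk] :=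
  boolP [exists k : 'I_(rk s), ht k == B]; last first.
  have [j Bj|//|w [w1 w2 w3]] := IH v Nv.
    by apply: v0; rewrite ltn_neqAle Bj andbT eq_sym nk.
  by exists w; split => // p Bp; apply: w2; apply: ltnW.
have [|bT|c [c1 c2 c3]] := @ideal_gen (lab k) (v 0 k) b.
- by apply: (filtered_lead NP) => // j kj; rewrite v0 // -kB.
- exact: vh.
have [Nu u0 uh uk] := slice_sub k c.
set u := \sum_(i | _) _ in Nu u0 uh uk.
have [||bT j|w [w1 w2 w3]] := IH (v - u).
- by rewrite addrC -scaleN1r; apply: filteredP.
- move=> j Bj; rewrite !mxE; have [->|jk] := eqVneq j k.
    by rewrite uk // -c3 subrr.
  have ltj : (B < ht j)%N.
    by rewrite ltn_neqAle Bj andbT -kB (inj_eq (ht_inj NP)) eq_sym.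
  by rewrite v0 // u0 ?kB // subrr.
- by rewrite !mxE; apply: in_highD; [apply: vh | apply/in_highN/uh/c2].
exists (fun p => (if p.1 == k then c p.2 else 0) + w p); split.
- move=> bT p; apply: in_maxD; last exact: w1.
  by case: ifP => _; [apply: c2 | apply: in_max0].
- move=> p Bp; rewrite (w2 p (ltnW Bp)) addr0; case: eqP => // pk.
  by move: Bp; rewrite pk kB ltnn.
under eq_bigr do rewrite scalerDl.
by rewrite big_split /= sum_new_index_slice -w3 addrC subrK.
Qed.

Lemma next_d_exact v : N v <-> exists w, w *m next_d = v.
Proof.
split=> [Nv|[w <-]]; last first.
  rewrite mulmx_sum_row; apply: filtered_sum => y _.
  by rewrite rowK; have [] := gP (enum_valP y).
have [||w [_ _ ->]] := @filtered_decomp false (\max_j @ht s j).+1 v Nv => //.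
  by move=> j; rewrite ltnNge leq_bigmax.
by exists (\row_y w (enum_val y)); rewrite mul_next_d.
Qed.

Lemma next_d_in_max i j : in_max (next_d i j).
Proof. by rewrite mxE; have [_ _ + _] := gP (enum_valP i); apply. Qed.

(** At coordinate [k], a syzygy with last entry at (k, i0) is a relation among monomials, so that
    entry lies in the colon ideal. Conversely, a monomial relation gives an element of [N] supported
    below [k], and subtracting its decomposition leaves the leading entry unchanged. *)
Lemma filtered_next : @filtered (next_shape s) (fun v => v *m next_d = 0).
Proof.
split=> /=.
- move=> y z /= e.
  have e1 := congr1 (divn^~ m) e; have e2 := congr1 (modn^~ m) e.
  move: e1 e2; rewrite /= !divnMDl ?m_gt0 // !divn_small // !addn0.
  rewrite !modnMDl !modn_small // => /(ht_inj NP) e1 /val_inj e2.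
  apply: enum_val_inj; move: e1 e2.
  by case: (enum_val y) (enum_val z) => [a b] [a' b'] /= -> ->.
- by rewrite mul0mx.
- by move=> a u v u0 v0; rewrite mulmxDl -scalemxAl u0 v0 scaler0 addr0.
- move=> v y0 vD vs.
  set k := (enum_val y0).1; set i0 := (enum_val y0).2.
  have ey0 : enum_val y0 = (k, i0) by rewrite -surjective_pairing.
  (* [c i] is the entry of [v] at (k, i), or 0 if that pair is not a coordinate. *)
  pose c i := \sum_(y | enum_val y == (k, i)) v 0 y.
  have -> : v 0 y0 = c i0.
    rewrite /c (big_pred1 y0) // => y.
    by rewrite -ey0 (inj_eq enum_val_inj).
  apply: syzygy_lead.
  + move=> i ii0; apply: big1 => y /eqP ey; apply: vs.
    by rewrite ey ey0 /= ltn_add2l.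
  + move=> i ein; apply: big_pred0 => y; apply/negP => /eqP ey.
    have := enum_valP y; rewrite ey unfold_in /new_index /= ein.
    by case: lab => //= b; rewrite eqxx.
  have := congr1 (fun u : 'rV_(rk s) => u 0 k) vD.
  rewrite !mxE => e; rewrite -[RHS]e.
  rewrite (bigID (fun y => (enum_val y).1 == k)) /= [X in _ + X]big1 ?addr0.
    rewrite (partition_big (fun y => (enum_val y).2) xpredT) //=.
    apply: eq_bigr => i _; rewrite /c big_distrl /=; apply: eq_big.
      by move=> y; case: (enum_val y) => a b; rewrite xpair_eqE.
    move=> y /eqP ey; rewrite mxE.
    by have [_ _ _] := gP (enum_valP y); rewrite ey => ->.
  move=> y yk; rewrite mxE; have [lt|gt|/(ht_inj NP) eq] :=
    ltngtP (ht (enum_val y).1) (ht k).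
  + by have [_ g0 _ _] := gP (enum_valP y); rewrite g0 ?mulr0.
  + rewrite vs ?mul0r // ey0 /=.
    exact: lex_ltn.
  + by rewrite eq eqxx in yk.
- move=> y0 i' gi'.
  have gi0 := enum_valP y0; move: gi'.
  set k := (enum_val y0).1; set i0 := (enum_val y0).2 => gi'.
  have ey0 : enum_val y0 = (k, i0) by rewrite -surjective_pairing.
  have [c [c1 c2 c3 c4 c5]] := syzygy_lift gi0 gi'.
  have [Nu u0 uh uk] := slice_sub k c.
  set u := \sum_(i | _) _ in Nu u0 uh uk.
  (* The relation kills the entry of [u] at [k], and all entries lie in t^(2m)K[t]; hence the
     correction [w] lives below [k] and takes values in M. *)
  have [||w [w1 w2 w3]] := @filtered_decomp true (ht k) u Nu.
  + move=> j; rewrite leq_eqVlt => /predU1P[/(ht_inj NP)<-|/u0//].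
    by rewrite uk // c5.
  + by move=> _; apply: uh.
  pose q p := (if p.1 == k then c p.2 else 0) - w p.
  exists (\row_y q (enum_val y)); split.
  + rewrite mul_next_d /q; under eq_bigr do rewrite scalerBl.
    by rewrite sumrB sum_new_index_slice -w3 subrr.
  + move=> y; rewrite mxE /q /=; case: eqP => [ek|nk].
      by rewrite ek ltn_add2l => /c2->; rewrite w2 ?ek // subrr.
    by move=> lt; rewrite w2 ?subrr //; apply: lex_leq lt.
  + move=> y; rewrite mxE /q; apply: in_maxD; last exact/in_maxN/w1.
    by case: ifP => _; [apply: c3 | apply: in_max0].
  + by rewrite mxE /q ey0 /= eqxx w2 // subr0 c4.
Qed.

End Step.

Lemma filtered_step s (N : 'rV[R]_(rk s) -> Prop) : filtered N ->
  exists D : 'M[R]_(rk (next_shape s), rk s),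
    [/\ forall i j, in_max (D i j), forall v, N v <-> exists w, w *m D = v &
        @filtered (next_shape s) (fun v => v *m D = 0)].
Proof.
move=> NP.
have /choice[g gP] : forall p : 'I_(rk s) * 'I_m, exists g,
    p \in new_index s ->
    [/\ N g, forall j, (ht p.1 < ht j)%N -> g 0 j = 0,
        forall j, in_max (g 0 j) & g 0 p.1 = sgmon (m + p.2)%N].
  move=> p; have [pA|] := boolP (p \in new_index s); last by exists 0.
  by have [g gP] := filtered_gen NP pA; exists g.
exists (next_d g); split.
- exact: (next_d_in_max gP).
- exact: (next_d_exact NP gP).
- exact: (filtered_next NP gP).
Qed.

(** * The minimal resolution of the residue field *)

Definition shape0 : shape := @Shape 1 (fun=> 0%N) (fun=> Some true).

Definition shapes (i : nat) : shape := iter i next_shape shape0.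

Lemma filtered_base : @filtered shape0 (fun v => in_max (v 0 0)).
Proof.
split=> /=.
- by move=> x y _; rewrite !ord1.
- by rewrite mxE; apply: in_max0.
- move=> a u v u0 v0; rewrite !mxE; apply: in_maxD => //.
  by rewrite /in_max sgvalM coef0M u0 mulr0.
- by move=> v k v0 _; rewrite ord1; split; [|left].
- move=> k i gi; have Si := @gens_Gamma (Some true) i gi.
  exists (const_mx (sgmon (m + i)%N)); split => //; rewrite ?mxE //.
    by apply: in_max_sgmon => //; lia.
  by move=> j; rewrite mxE; apply: in_max_sgmon => //; lia.
Qed.

Definition aug_row (v : 'rV[R]_1) : scalar_module (@sgaug K (Gamma m n)) :=
  sgaug (v 0 0).

Fact aug_row_is_linear : linear aug_row.
Proof. by move=> a u v; rewrite /aug_row !mxE rmorphD rmorphM. Qed.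

HB.instance Definition _ := GRing.isLinear.Build R 'rV[R]_1
  (scalar_module (@sgaug K (Gamma m n))) _ aug_row aug_row_is_linear.

Lemma minimal_resolution :
  exists2 F : free_resolution (scalar_module (@sgaug K (Gamma m n))),
    forall i, map_mx (@sgaug K (Gamma m n)) (res_d F i) = 0 &
    forall i, res_rank F i = rk (shapes i).
Proof.
pose T i := 'rV[R]_(rk (shapes i)) -> Prop.
(* The differential is hidden in an existential, with the next submodule fixed as its kernel; [cid]
   extracts it once the whole sequence is chosen. *)
pose step i (N : T i) (N' : T i.+1) :=
  exists D : 'M[R]_(rk (shapes i.+1), rk (shapes i)),
  [/\ forall j k, in_max (D j k), forall v, N v <-> exists w, w *m D = v &
      N' = fun v => v *m D = 0].
have stepP i (N : T i) : filtered N -> exists2 N', step i N N' & filtered N'.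
  move=> /filtered_step[D [D1 D2 D3]].
  by exists (fun v => v *m D = 0) => //; exists D.
have [N N0 NP] := @dependent_choice_nat T (fun i => @filtered (shapes i))
  step _ filtered_base stepP.
pose D i := projT1 (cid (NP i)).
have DP i : [/\ forall j k, in_max (D i j k),
    forall v, N i v <-> exists w, w *m D i = v &
    N i.+1 = fun v => v *m D i = 0] := projT2 (cid (NP i)).
have surj x : exists v, aug_row v = x.
  exists (const_mx (sgconst x)); rewrite /aug_row mxE /sgaug val_sgconst.
  by rewrite coefC.
have ex0 (v : 'rV[R]_(rk (shapes 0))) :
    aug_row v = 0 <-> exists w, w *m D 0 = v.
  by have [_ <- _] := DP 0%N; rewrite N0.
have exS i (v : 'rV[R]_(rk (shapes i.+1))) :
    v *m D i = 0 <-> exists w, w *m D i.+1 = v.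
  by have [_ <- _] := DP i.+1; have [_ _ ->] := DP i.
exists (@FreeResolution _ (scalar_module (@sgaug K (Gamma m n)))
  (fun i => rk (shapes i)) D aug_row surj ex0 exS) => // i /=.
by apply/matrixP => j k; rewrite !mxE; have [Dm _ _] := DP i; apply: Dm.
Qed.

(** * Counting ranks and the generating series *)

Definition label_count (b : bool) (s : shape) : nat :=
  \sum_(k < rk s) (lab k == Some b).

Lemma sum_next_shape s (phi : option bool -> nat) :
  (\sum_(y < rk (next_shape s)) phi (lab y) =
   label_count true s *
     (\sum_(i < m | gens (Some true) i) phi (colon_label i)) +
   label_count false s *
     (\sum_(i < m | gens (Some false) i) phi (colon_label i)))%N.
Proof.
transitivity (\sum_(p in new_index s) phi (colon_label p.2))%N.
  by rewrite [RHS]big_enum_val.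
rewrite (@sum_new_index _ nat (fun p => phi (colon_label p.2))) /=.
rewrite /label_count !big_distrl /= -big_split /=; apply: eq_bigr => k _.
case: (lab k) => [[]|] /=; rewrite ?mul1n ?mul0n ?addn0 ?add0n //.
by rewrite big_pred0.
Qed.

(** Over all i < m the colon labels are 0, I and then m-2 times M; dropping n, or n and n-1, drops
    only labels M, both indices being at least 2. *)
Lemma sum_gens (phi : option bool -> nat) (a := phi None)
    (b := phi (Some false)) (c := phi (Some true)) :
  (\sum_(i < m | gens (Some true) i) phi (colon_label i) + c
     = a + b + (m - 2) * c /\
   \sum_(i < m | gens (Some false) i) phi (colon_label i) + 2 * c
     = a + b + (m - 2) * c)%N.
Proof.
have on : (n < m)%N := hm; have on1 : (n.-1 < m)%N by lia.
have newn : colon_label n = Some true by case: (n) hn => [|[|]].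
have newn1 : colon_label n.-1 = Some true by case: (n) hn => [|[|[|]]].
have tot : (\sum_(i < m) phi (colon_label i) = a + b + (m - 2) * c)%N.
  have em : m = (m - 2).+2 by lia.
  rewrite [in LHS]em !big_ord_recl /= addnA; congr addn.
  by rewrite sum_nat_const card_ord.
have totT : (\sum_(i < m | gens (Some true) i) phi (colon_label i) + c
             = a + b + (m - 2) * c)%N.
  rewrite -tot [RHS](bigD1 (Ordinal on)) //= newn addnC; congr addn.
  by apply: eq_bigl => i; rewrite andbT -val_eqE.
have totF : (\sum_(i < m | gens (Some true) i) phi (colon_label i) =
    \sum_(i < m | gens (Some false) i) phi (colon_label i) + c)%N.
  rewrite (bigD1 (Ordinal on1)) /=; last by rewrite andbT; lia.
  rewrite newn1 addnC; congr addn.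
  by apply: eq_bigl => i; rewrite /= andbT -val_eqE.
by split=> //; rewrite -totT totF mul2n -addnn addnA.
Qed.

Lemma shapes_rec i :
  let a := (label_count true (shapes i))%:Z in
  let b := (label_count false (shapes i))%:Z in
  [/\ (rk (shapes i.+1))%:Z = (m%:Z - 1) * a + (m%:Z - 2) * b,
      (label_count true (shapes i.+1))%:Z = (m%:Z - 3) * a + (m%:Z - 4) * b &
      (label_count false (shapes i.+1))%:Z = 1 * a + 1 * b].
Proof.
move=> a b; rewrite /a /b; have -> : shapes i.+1 = next_shape (shapes i) by [].
(* [x] and [y] are the contributions of one label M and of one label I; they differ by the weight of
   M, for the generator t^(m+n-1). *)
have count (phi : option bool -> nat) (x y : int) :
    (phi None + phi (Some false) + (m - 2) * phi (Some true))%N%:Z =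
      x + (phi (Some true))%:Z ->
    x - y = (phi (Some true))%:Z ->
    (\sum_(j < rk (next_shape (shapes i))) phi (lab j))%N%:Z =
      x * (label_count true (shapes i))%:Z +
      y * (label_count false (shapes i))%:Z.
  move=> ex ey; have [eT eF] := sum_gens phi; rewrite sum_next_shape.
  rewrite PoszD !PoszM [x * _]mulrC [y * _]mulrC.
  by congr (_ * _ + _ * _); lia.
split.
- rewrite -(count (fun=> 1%N)) ?sum1_card ?card_ord //; lia.
- rewrite -(count (fun l => (l == Some true) : nat)) //=; lia.
- rewrite -(count (fun l => (l == Some false) : nat)) //=; lia.
Qed.

(** The recurrence on (a, b) has trace (m-3) + 1 = m-2 and determinant (m-3) - (m-4) = 1, so the
    ranks obey the recurrence with characteristic polynomial x^2 - (m-2)x + 1 encoded by the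
    denominator; the numerator accounts for the first ranks 1 and m-1. *)
Lemma rank_series : (fun i => (rk (shapes i))%:Z) =1
  fps_div (fps_of_poly (1 + 'X : {poly int}))
          (fps_of_poly (1 - (m%:Z - 2)%:P * 'X + 'X^2)).
Proof.
set d : {poly int} := 1 - _ + _.
have dE j : d`_j = (j == 0%N)%:R - (m%:Z - 2) * (j == 1%N)%:R + (j == 2%N)%:R.
  by rewrite /d coefD coefB coef1 coefCM coefX coefXn.
have [r1 A1 B1] := shapes_rec 0; have [r2 _ _] := shapes_rec 1.
have A0 : label_count true (shapes 0) = 1%N by rewrite /label_count big_ord1.
have B0 : label_count false (shapes 0) = 0%N by rewrite /label_count big_ord1.
apply: fps_div_uniq; first by rewrite /fps_of_poly dE mulr0 subr0 addr0 unitr1.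
case=> [|[|N]]; rewrite /fps_mul /fps_of_poly.
- by rewrite big_ord1 dE coefD coef1 coefX /=; ring.
- rewrite !big_ord_recr big_ord0 /= !dE coefD coef1 coefX /= r1 A0 B0 /=; ring.
rewrite !big_ord_recr /= big1 => [|k _]; last first.
  rewrite dE; have := ltn_ord k.
  by do 3![case: eqP => [|_]; first lia]; rewrite !mulr0.
rewrite subnn subSnn; have -> : (N.+2 - N = 2)%N by lia.
rewrite !dE coefD coef1 coefX /=.
(* Degree 2 involves the initial rank 1, which [shapes_rec] does not express through labels, so it
   is computed apart. *)
case: N => [|N].
  by rewrite r2 r1 A1 B1 A0 B0 /=; ring.
have [-> _ _] := shapes_rec N.+2.
have [-> -> ->] := shapes_rec N.+1.
have [-> -> ->] := shapes_rec N; ring.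
Qed.

End Ideals.

Theorem theorem2 (K : fieldType) (m n : nat) (hn : (3 <= n)%N) (hm : (n < m)%N) :
  exists2 beta : nat -> nat,
    betti_numbers (@sgaug K (Gamma m n)) beta &
    (fun i => (beta i)%:Z) =1
      fps_div (fps_of_poly (1 + 'X : {poly int}))
              (fps_of_poly (1 - (m%:Z - 2)%:P * 'X + 'X^2)).
Proof.
have [F Fmin Frk] := minimal_resolution K hn hm.
exists (fun i => rk (shapes m n i)); last exact: rank_series.
split=> [|G i]; first exact: (inhabits F).
(* Tor computed from any [G] agrees with that from the minimal [F], where it is the rank. *)
by rewrite (tor_dim_unique _ G F) tor_dim_minimal.
Qed.
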